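(* Let $B$ be a finite connected graph of positive order without half-loops. Let $s\ge1$, let $\vec m=(m_1,\dots,m_s)$ and $\vec k_0=(k_1^0,\dots,k_s^0)$ be $s$-tuples of positive integers, and let $g_1,\dots,g_s$ be $B$-Ramanujan functions. Then the truncated weighted convolution $(g_1\ast\cdots\ast g_s)^{\vec k_0}_{\vec m}$ is a $B$-Ramanujan function.
   Context: Graphs may have multiple edges and whole-loops; order is $|E|-|V|$. $H_B$ is the Hashimoto matrix of $B$ (indexed by directed edges, $(e,e')$ entry $1$ iff $h(e)=t(e')$ and $e'\ne e^{-1}$), $\rho$ spectral radius. A function $P$ on nonnegative integers is $B$-Ramanujan if $P(k)=\sum_{\mu\in\mathrm{Spec}(H_B)}\mu^kp_\mu(k)+e(k)$ with polynomials $p_\mu$, and for every $\epsilon>0$ there is $C$ with $|e(k)|\le C(\rho(H_B)+\epsilon)^{k/2}$ for all $k$. The truncated weighted convolution is $(g_1\ast\cdots\ast g_s)^{\vec k_0}_{\vec m}(k)=\sum g_1(k_1)\cdots g_s(k_s)$, the sum over all integer vectors $\vec k=(k_1,\dots,k_s)$ with $k_i\ge k_i^0$ and $\sum_im_ik_i=k$. *)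

(* Defs.v *)
From mathcomp Require Import all_boot all_order all_algebra complex.
From mathcomp Require Import reals.
Set Implicit Arguments. Unset Strict Implicit. Unset Printing Implicit Defensive.
Import Order.TTheory GRing.Theory Num.Theory.
Local Open Scope ring_scope.

(* A finite graph (multiple edges, whole-loops allowed) is given by a finite
   vertex type V, a finite type D of directed edges, a tail map tl : D -> V and
   an involution inv : D -> D (e |-> e^{-1}); the head is h(e) := t(e^{-1}).
   Each undirected edge corresponds to an orbit {e, e^{-1}} of inv; a half-loop
   would be a fixed point of inv. *)

Section Graphs.
Variables (V D : finType) (tl : D -> V) (inv : D -> D).

Definition hd (e : D) : V := tl (inv e).

Definition is_graph : Prop := involutive inv.

Definition no_half_loops : Prop := forall e : D, inv e != e.

Definition adj : rel V := fun u v => [exists e : D, (tl e == u) && (hd e == v)].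
Definition connected_graph : Prop := forall u v : V, connect adj u v.

(* order |E| - |V| is positive; without half-loops |E| = |D|/2 *)
Definition positive_order : Prop := (#|V| * 2 < #|D|)%N.

Definition hashimoto (R : nzRingType) : 'M[R]_#|D| :=
  \matrix_(i, j) (if (hd (enum_val i) == tl (enum_val j))
                       && (enum_val j != inv (enum_val i)) then 1 else 0).
End Graphs.

Section Spectral.
Variable (R : realType).
Local Notation C := (R[i]).

Definition spec n (A : 'M[C]_n) : seq C :=
  undup (sval (closed_field_poly_normal (char_poly A))).

Definition spec_radius n (A : 'M[C]_n) : C :=
  \big[Num.max/0]_(mu <- spec A) `|mu|.

Definition ramanujan n (A : 'M[C]_n) (P : nat -> C) : Prop :=
  exists p : C -> {poly C},
    forall eps : C, 0 < eps ->
      exists K : C, forall k : nat,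
        `|P k - \sum_(mu <- spec A) mu ^+ k * (p mu).[k%:R]|
          <= K * (sqrtC (spec_radius A + eps)) ^+ k.

(* truncated weighted convolution; for positive weights m_i, every admissible
   vector has k_i <= k, so the sum ranges over finite functions 'I_s -> 'I_(k+1) *)
Definition trunc_conv (s : nat) (g : 'I_s -> nat -> C) (k0 m : 'I_s -> nat)
    (k : nat) : C :=
  \sum_(kk : {ffun 'I_s -> 'I_k.+1} |
          [forall i, (k0 i <= kk i)%N] && ((\sum_i m i * kk i)%N == k))
     \prod_i g i (kk i).
End Spectral.

(* Main.v *)
Require Import Defs.
From mathcomp Require Import all_boot all_order all_algebra complex.
From mathcomp Require Import reals boolp topology normedtype sequences.
From mathcomp Require Import ring.
Set Implicit Arguments. Unset Strict Implicit. Unset Printing Implicit Defensive.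
Import Order.TTheory GRing.Theory Num.Theory numFieldNormedType.Exports.
Local Open Scope ring_scope.

(** Write rho for the spectral radius. The truncated weighted convolution is
    the Cauchy product of the dilated functions [n |-> g_i (n / m_i)], so it
    suffices that the Ramanujan functions are stable under dilation and Cauchy
    product.

    Dilation by 1 changes finitely many values; dilation by [m >= 2] turns growth
    rho^k into growth rho^(k/2), which is an error term. Both use rho >= 1, and
    1 is indeed an eigenvalue of the Hashimoto matrix: it fixes every
    antisymmetric divergence-free flow, and a nonzero one exists because
    |E| > |V|.

    For Cauchy products, the functions [mu^k p(k)] are spanned by the coefficients
    of [1 / (1 - mu X)^d], so one only has to multiply by [1 / (1 - mu X)]. On
    such exponential polynomials this is a partial fraction decomposition. On an
    error term it is again an error term if |mu| <= sqrt rho, and otherwise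
    [c mu^k] plus the tail of an absolutely convergent series. *)

(** * The Cauchy product of sequences *)

Section Convolution.
Variable A : comNzRingType.
Implicit Types f g h : nat -> A.

Definition conv f g k : A := \sum_(i < k.+1) f i * g (k - i)%N.

Definition unit_seq (k : nat) : A := (k == 0%N)%:R.

(** Each value of [conv] sees only finitely many terms, so commutativity and associativity can be
    inherited from [{poly A}] through truncations. *)
Lemma coef_mul_conv f g n (p q : {poly A}) :
    (forall k, (k < n)%N -> p`_k = f k) -> (forall k, (k < n)%N -> q`_k = g k) ->
  forall k, (k < n)%N -> (p * q)`_k = conv f g k.
Proof.
move=> Hp Hq k lt_kn; rewrite coefM; apply: eq_bigr => i _.
by rewrite Hp ?Hq ?(leq_ltn_trans (leq_subr _ _) lt_kn) ?(leq_trans (ltn_ord i)).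
Qed.

Let trunc f n := \poly_(i < n) f i.

Let coef_trunc f n k : (k < n)%N -> (trunc f n)`_k = f k.
Proof. by move=> ltkn; rewrite coef_poly ltkn. Qed.

Let conv_coef f g n k : (k < n)%N -> (trunc f n * trunc g n)`_k = conv f g k.
Proof. by apply: coef_mul_conv; apply: coef_trunc. Qed.

Lemma convC f g : conv f g = conv g f.
Proof. by apply: funext => k; rewrite -!(@conv_coef _ _ k.+1) // mulrC. Qed.

Lemma convA f g h : conv f (conv g h) = conv (conv f g) h.
Proof.
apply: funext => k; set n := k.+1.
rewrite -(@coef_mul_conv _ _ n (trunc f n) (trunc g n * trunc h n)) //;
  [|exact: coef_trunc|exact: conv_coef].
rewrite -(@coef_mul_conv _ _ n (trunc f n * trunc g n) (trunc h n)) //;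
  [by rewrite mulrA|exact: conv_coef|exact: coef_trunc].
Qed.

Lemma conv_unit f : conv f unit_seq = f.
Proof.
apply: funext => k; rewrite /conv big_ord_recr /= subnn mulr1 big1 ?add0r // => i _.
by rewrite /unit_seq subn_eq0 leqNgt ltn_ord mulr0.
Qed.

Lemma convDr f g h : conv f (fun k => g k + h k) = fun k => conv f g k + conv f h k.
Proof.
by apply: funext => k; rewrite -big_split; apply: eq_bigr => i _; rewrite mulrDr.
Qed.

Lemma convZr f c g : conv f (fun k => c * g k) = fun k => c * conv f g k.
Proof.
by apply: funext => k; rewrite big_distrr; apply: eq_bigr => i _; rewrite mulrCA.
Qed.

Lemma convDl f g h : conv (fun k => g k + h k) f = fun k => conv g f k + conv h f k.
Proof. by rewrite convC convDr !(convC f). Qed.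

Lemma convZl f c g : conv (fun k => c * g k) f = fun k => c * conv g f k.
Proof. by rewrite convC convZr (convC f). Qed.

Definition geom (mu : A) k := mu ^+ k.

Lemma conv_geomS mu f k :
  conv (geom mu) f k.+1 = mu * conv (geom mu) f k + f k.+1.
Proof.
rewrite /conv big_ord_recl /geom expr0 mul1r subn0 addrC big_distrr /=.
by congr (_ + _); apply: eq_bigr => i _; rewrite exprS mulrA subSS.
Qed.

(** [geom mu] is the power series inverse of [1 - mu X], so convolving with it amounts to solving
    this first-order recurrence. *)
Lemma conv_geomE mu f h :
    h 0%N = f 0%N -> (forall k, h k.+1 = mu * h k + f k.+1) ->
  conv (geom mu) f = h.
Proof.
move=> h0 hS; apply: funext; elim=> [|k IHk]; last by rewrite conv_geomS IHk hS.
by rewrite /conv big_ord_recl big_ord0 addr0 subnn h0 mul1r.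
Qed.

Lemma conv_geom_geom mu nu k :
  (mu - nu) * conv (geom mu) (geom nu) k = mu ^+ k.+1 - nu ^+ k.+1.
Proof.
rewrite subrXX convC; congr (_ * _); apply: eq_bigr => i _.
by rewrite mulrC.
Qed.

(* The coefficients of [1 / (1 - mu X) ^ (d + 1)]. *)
Definition negbin (mu : A) d k := mu ^+ k * 'C(k + d, d)%:R.

Lemma negbin0 mu : negbin mu 0 = geom mu.
Proof. by apply: funext => k; rewrite /negbin bin0 mulr1. Qed.

Lemma conv_geom_negbin mu d : conv (geom mu) (negbin mu d) = negbin mu d.+1.
Proof.
apply: conv_geomE => [|k]; rewrite /negbin ?add0n ?binn //.
by rewrite addnS addSn binS addnS natrD mulrDr exprS mulrA.
Qed.

End Convolution.

(** * Properties stable under linear combination, and exponential polynomials *)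

Section LinearPredicates.
Variable F : numFieldType.
Implicit Types (f g : nat -> F) (Q : (nat -> F) -> Prop).

Definition linear_pred Q : Prop :=
  (forall f g, Q f -> Q g -> Q (fun k => f k + g k))
  /\ (forall c f, Q f -> Q (fun k => c * f k)).

Lemma linear_pred_sum Q (I : eqType) (r : seq I) (f : I -> nat -> F) g :
    linear_pred Q -> Q g -> (forall i, i \in r -> Q (f i)) ->
  Q (fun k => \sum_(i <- r) f i k + g k).
Proof.
case=> QD _ Qg; elim: r => [|i r IHr] Hr.
  by rewrite (_ : (fun k => _) = g) //; apply: funext => k; rewrite big_nil add0r.
under eq_fun do rewrite big_cons -addrA.
apply: QD; first by apply: Hr; rewrite mem_head.
by apply: IHr => j jr; apply: Hr; rewrite in_cons jr orbT.
Qed.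

(* The span of the [negbin mu d], [d >= 0], is stable under multiplication by
   the index [k], hence contains every [mu ^+ k * p.[k]]. *)
Lemma exp_poly_ind Q mu (p : {poly F}) :
    linear_pred Q -> (forall d, Q (negbin mu d)) ->
  Q (fun k => mu ^+ k * p.[k%:R]).
Proof.
move=> [QD QZ] QN; rewrite (_ : (fun k => _) = fun k => negbin mu 0 k * p.[k%:R]);
  last by rewrite negbin0.
have Q0 : Q (fun _ => 0).
  rewrite (_ : (fun _ => 0) = fun k => 0 * negbin mu 0 k); first exact: QZ.
  by apply: funext => k; rewrite mul0r.
elim/poly_ind: p 0%N => [|p c IHp] d.
  by rewrite (_ : (fun k => _) = fun _ => 0) //; apply: funext => k; rewrite horner0 mulr0.
(* Multiplication by the index rests on [k 'C(k+d, d) = (d+1) ['C(k+d+1, d+1) - 'C(k+d, d)]]; it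
   raises [d], hence the induction is general in [d]. *)
rewrite (_ : (fun k => _) = fun k =>
   (d.+1%:R * (negbin mu d.+1 k * p.[k%:R]) + - d.+1%:R * (negbin mu d k * p.[k%:R]))
   + c * negbin mu d k); last first.
  apply: funext => k; rewrite hornerMXaddC /negbin.
  have /(congr1 (fun n => n%:R : F)) := mul_bin_diag (k + d.+1) d.
  rewrite addnS /= !natrM -addnS natrD => E.
  have -> : d.+1%:R * (mu ^+ k * 'C(k + d.+1, d.+1)%:R * p.[k%:R]) =
     (d.+1%:R * 'C(k + d.+1, d.+1)%:R) * mu ^+ k * p.[k%:R] by ring.
  by rewrite -E; ring.
by apply: (QD); first apply: (QD); apply: (QZ).
Qed.

End LinearPredicates.

(** * Exponential growth rates *)

Section Growth.
Variable F : numFieldType.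
Implicit Types (f g : nat -> F) (r s t q : F).

(** Asking for a bound only at rates strictly above [r] absorbs polynomial factors and takes over
    the role of [eps] in [ramanujan]. *)
Definition growth r f : Prop :=
  forall t, r < t -> exists K, forall k, `|f k| <= K * t ^+ k.

Lemma bound_ge0 f K t : (forall k, `|f k| <= K * t ^+ k) -> 0 <= K.
Proof. by move/(_ 0%N); rewrite mulr1; apply: le_trans. Qed.

Lemma growth_linear r : linear_pred (growth r).
Proof.
split=> [f g Hf Hg|c f Hf] t /[dup] /Hf[K HK].
  move=> /Hg[L HL]; exists (K + L) => k.
  by rewrite mulrDl; apply: le_trans (ler_normD _ _) (lerD _ _).
by exists (`|c| * K) => k; rewrite normrM -mulrA ler_wpM2l.
Qed.

Lemma growth_le r s f : r <= s -> growth r f -> growth s f.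
Proof. by move=> le_rs Hf t lt_st; apply: Hf; apply: le_lt_trans lt_st. Qed.

Lemma growth_geom r mu : `|mu| <= r -> growth r (geom mu).
Proof.
move=> le_mur t lt_rt; have le_mut := le_trans le_mur (ltW lt_rt).
exists 1 => k; rewrite mul1r normrX lerXn2r ?nnegrE //.
exact: le_trans (normr_ge0 _) le_mut.
Qed.

Lemma growth_fin_support r f n :
  1 <= r -> (forall k, (n <= k)%N -> f k = 0) -> growth r f.
Proof.
move=> r1 Hf t lt_rt; have t1 := le_trans r1 (ltW lt_rt).
exists (\sum_(i < n) `|f i|) => k.
case: (ltnP k n) => [lt_kn|/Hf->]; last first.
  rewrite normr0 mulr_ge0 ?sumr_ge0 // exprn_ge0 //.
  exact: le_trans ler01 t1.
rewrite (bigD1 (Ordinal lt_kn)) //= -[leLHS]mulr1 ler_pM //.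
  by rewrite lerDl sumr_ge0.
exact: exprn_ege1.
Qed.

(** A bound at the midpoint of [r] and [s] also serves every [t >= s]. This is for series that
    converge only at rates below [s]. *)
Lemma growth_below r s f : 0 <= r -> r < s ->
  (forall t, r < t -> t < s -> exists K, forall k, `|f k| <= K * t ^+ k) ->
  growth r f.
Proof.
move=> r0 lt_rs Hf t lt_rt.
have t0 := le_trans r0 (ltW lt_rt); have s0 := le_trans r0 (ltW lt_rs).
have [lt_ts|le_st] := real_ltP (ger0_real t0) (ger0_real s0); first exact: Hf.
have [lt_rm lt_ms] := midf_lt lt_rs.
have [K HK] := Hf _ lt_rm lt_ms; exists K => k; apply: le_trans (HK k) _.
have m0 := le_trans r0 (ltW lt_rm).
rewrite ler_wpM2l ?(bound_ge0 HK) // lerXn2r ?nnegrE //.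
exact: le_trans (ltW lt_ms) le_st.
Qed.

Lemma geom_sum_le q n : 0 <= q -> q < 1 -> \sum_(i < n) q ^+ i <= (1 - q)^-1.
Proof.
move=> q0 q1; have q1' : 0 < 1 - q by rewrite subr_gt0.
rewrite -[leRHS]mul1r ler_pdivlMr // mulrC.
have /(congr1 -%R) := subrX1 q n; rewrite -mulNr !opprB => <-.
by rewrite lerBlDr lerDl exprn_ge0.
Qed.

(** Bounding [f] at a rate [s] strictly between [r] and [t], and [g] at rate [t], leaves [t ^+ k]
    times a geometric sum of ratio [s / t < 1]. *)
Lemma growth_conv r f g : 0 <= r -> growth r f -> growth r g -> growth r (conv f g).
Proof.
move=> r0 Hf Hg t lt_rt; have [lt_rs lt_st] := midf_lt lt_rt.
set s := (_ / _) in lt_rs lt_st.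
have [K HK] := Hf _ lt_rs; have [L HL] := Hg _ lt_rt.
have s0 := le_trans r0 (ltW lt_rs); have t0 : 0 < t := le_lt_trans s0 lt_st.
have K0 := bound_ge0 HK; have L0 := bound_ge0 HL.
exists (K * L * (1 - s / t)^-1) => k.
apply: le_trans (_ : \sum_(i < k.+1) K * L * t ^+ k * (s / t) ^+ i <= _).
  apply: le_trans (ler_norm_sum _ _ _) _; apply: ler_sum => i _.
  have -> : K * L * t ^+ k * (s / t) ^+ i = (K * s ^+ i) * (L * t ^+ (k - i)).
    have -> : t ^+ k = t ^+ (k - i) * t ^+ i by rewrite -exprD subnK // -ltnS.
    rewrite expr_div_n.
    by field; rewrite expf_neq0 // lt0r_neq0.
  by rewrite normrM ler_pM.
rewrite -big_distrr /= -[leRHS]mulrA [X in _ <= _ * X]mulrC mulrA.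
rewrite ler_wpM2l ?mulr_ge0 ?exprn_ge0 ?(ltW t0) // geom_sum_le //.
  by rewrite divr_ge0 // ltW.
by rewrite ltr_pdivrMr ?mul1r.
Qed.

Lemma growth_negbin r mu d : 0 <= r -> `|mu| <= r -> growth r (negbin mu d).
Proof.
move=> r0 Hmu; elim: d => [|d IHd]; first by rewrite negbin0; apply: growth_geom.
by rewrite -conv_geom_negbin; apply: growth_conv => //; apply: growth_geom.
Qed.

End Growth.

(** * The eigenvalue 1 of the Hashimoto matrix *)

Section Flows.
Variables (V D : finType) (tl : D -> V) (inv : D -> D) (F : fieldType).
Hypotheses (invK : involutive inv) (inv_neq : no_half_loops inv).

(* Antisymmetric flows [f (inv e) = - f e] with zero divergence at every vertex
   are fixed by the Hashimoto matrix, and there are at least |D|/2 - |V|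
   independent ones. *)
Lemma hashimoto_eigenvalue1 :
  positive_order V D -> eigenvalue (hashimoto tl inv F) 1.
Proof.
(* [S] selects one orientation of each edge. *)
move=> Hpos; pose S := [set e : D | (enum_rank e < enum_rank (inv e))%N].
have inS e : (inv e \in S) = (e \notin S).
  rewrite !inE invK -leqNgt ltn_neqAle; case: eqP => // /ord_inj/enum_rank_inj Ee.
  by case/eqP: (inv_neq e).
have cardS : (#|S| * 2 = #|D|)%N.
  rewrite muln2 -addnn -(cardsC S); congr (_ + _)%N.
  rewrite -(card_imset _ (inv_inj invK)); apply: eq_card => e.
  by rewrite -[in LHS](invK e) (mem_imset _ _ (inv_inj invK)) inS finset.in_setC.
(* Row [i] of [B] is the unit flow along the [i]-th edge of [S], and [N] sums a flow over the
   directed edges with a given head. [B *m N] has more rows than columns, so its left kernel yields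
   a divergence-free flow. *)
pose B := \matrix_(i < #|S|, j < #|D|)
  ((enum_val j == enum_val i)%:R - (inv (enum_val j) == enum_val i)%:R : F).
pose N := \matrix_(j < #|D|, v < #|V|) ((hd tl inv (enum_val j) == enum_val v)%:R : F).
have : kermx (B *m N) != 0.
  rewrite kermx_eq0 /row_free neq_ltn.
  apply/orP; left; apply: leq_ltn_trans (rank_leq_col _) _.
  by move: Hpos; rewrite /positive_order -cardS ltn_pmul2r.
case/rowV0Pn=> x /sub_kermxP; rewrite mulmxA => xBN x_neq0.
have fE j : (x *m B) 0 j = \sum_i x 0 i *
    ((enum_val j == enum_val i)%:R - (inv (enum_val j) == enum_val i)%:R).
  by rewrite mxE; apply: eq_bigr => i _; rewrite mxE.
have f_anti e : (x *m B) 0 (enum_rank (inv e)) = - (x *m B) 0 (enum_rank e).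
  rewrite !fE -sumrN; apply: eq_bigr => i _.
  by rewrite !enum_rankK invK -mulrN opprB.
have fBN v : \sum_(e | hd tl inv e == v) (x *m B) 0 (enum_rank e) = 0.
  have /matrixP/(_ 0 (enum_rank v)) := xBN; rewrite !mxE => H; rewrite -[RHS]H.
  rewrite (reindex enum_rank) /=; last by apply: onW_bij; apply: enum_rank_bij.
  rewrite big_mkcond; apply: eq_bigr => e _; rewrite [N _ _]mxE.
  by rewrite !enum_rankK; case: eqP; rewrite ?mulr1 ?mulr0.
apply/eigenvalueP; exists (x *m B); last first.
  (* On the selected orientation of the [i]-th edge the flow takes the value [x 0 i], so [x] can be
     read off from it. *)
  apply: contra_neq x_neq0 => xB0; apply/rowP => i; rewrite [RHS]mxE.
  have /rowP/(_ (enum_rank (enum_val i))) := xB0; rewrite fE enum_rankK mxE.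
  rewrite (bigD1 i) //= eqxx big1 ?addr0 => [|j neq_ji].
    case: eqP => [E|_]; last by rewrite subr0 mulr1.
    by have := inS (enum_val i); rewrite E enum_valP.
  rewrite (inj_eq enum_val_inj) eq_sym (negPf neq_ji).
  case: eqP => [E|_]; last by rewrite subrr mulr0.
  by have := inS (enum_val i); rewrite E !enum_valP.
rewrite scale1r; apply/rowP => j; rewrite mxE.
rewrite (reindex enum_rank) /=; last by apply: onW_bij; apply: enum_rank_bij.
set e' := enum_val j; have -> : j = enum_rank e' by rewrite enum_valK.
(* The total flow into [tl e'] is zero, and the only term absent from the Hashimoto sum is that of
   [inv e'], which is minus the flow on [e']. *)
rewrite -[e' in RHS]invK f_anti; apply/eqP; rewrite -subr_eq0 opprK.
apply/eqP; rewrite -[RHS](fBN (tl e')) [RHS](bigD1 (inv e')) /=; last by rewrite /hd invK.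
rewrite addrC; congr (_ + _); rewrite [RHS]big_mkcond.
apply: eq_bigr => e _; rewrite [hashimoto _ _ _ _ _]mxE !enum_rankK.
rewrite [e' == _]eq_sym (can2_eq invK invK).
by case: ifP; rewrite ?mulr1 ?mulr0.
Qed.

End Flows.

(** * Complex series with geometric bounds *)

Section Series.
Variable R : realType.

Lemma geom_bounded_is_cvg_series (x : nat -> R) (K q : R) : 0 <= q -> q < 1 ->
  (forall k, `|x k| <= K * q ^+ k) -> cvgn (series x).
Proof.
move=> q0 q1 Hx; apply: normed_cvg.
apply: (@series_le_cvg _ _ (geometric K q)) => [n||//|] /=.
- exact: normr_ge0.
- by move=> n; apply: le_trans (Hx n).
by apply: is_cvg_geometric_series; rewrite ger0_norm.
Qed.

Lemma normc_real (x : R) : `|x%:C%C| = `|x|%:C%C.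
Proof. by rewrite normc_def /= expr0n addr0 sqrtr_sqr. Qed.

Lemma normc_le_ReIm (z : R[i]) : `|z| <= (`|complex.Re z| + `|complex.Im z|)%:C%C.
Proof.
rewrite {1}[z]complexE; apply: le_trans (ler_normD _ _) _; rewrite normrM.
have -> : `|'i%C| = 1 :> R[i] by rewrite normc_def /= expr0n add0r expr1n sqrtr1.
by rewrite mul1r !normc_real rmorphD.
Qed.

Lemma normc_ge_Im (z : R[i]) : `|complex.Im z|%:C%C <= `|z|.
Proof.
have := normc_ge_Re (z * 'i%C); rewrite ReiNIm normrN normrM.
have -> : `|'i%C| = 1 :> R[i] by rewrite normc_def /= expr0n add0r expr1n sqrtr1.
by rewrite mulr1.
Qed.

Lemma geom_bounded_sum (a : nat -> R[i]) K q : 0 <= q -> q < 1 ->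
    (forall k, `|a k| <= K * q ^+ k) ->
  exists c, forall eps, 0 < eps ->
    exists N, forall n, (N <= n)%N -> `|\sum_(i < n) a i - c| <= eps.
Proof.
move=> q0 q1 Ha; have K0 := bound_ge0 Ha.
(* Nonnegative elements of [R[i]] are real, so [q] and [K] descend to [R] and the real and imaginary
   parts are summed separately. *)
have ge0_Re (z : R[i]) : 0 <= z -> exists x, z = x%:C%C.
  by move=> z0; exists (complex.Re z); rewrite RRe_real ?ger0_real.
have [q' Eq] := ge0_Re _ q0; have [K' EK] := ge0_Re _ K0; subst q K.
move: q' K' q0 q1 K0 Ha => q K q0 q1 _ Ha.
rewrite (lecR 0 q) in q0; rewrite (ltcR q 1) in q1.
have {}Ha k : `|a k| <= (K * q ^+ k)%:C%C by rewrite rmorphM rmorphXn.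
have /cvg_ex[l Hl] : cvgn (series (fun k => complex.Re (a k))).
  apply: (geom_bounded_is_cvg_series q0 q1) => k.
  by rewrite -lecR; apply: le_trans (normc_ge_Re _) (Ha k).
have /cvg_ex[l' Hl'] : cvgn (series (fun k => complex.Im (a k))).
  apply: (geom_bounded_is_cvg_series q0 q1) => k.
  by rewrite -lecR; apply: le_trans (normc_ge_Im _) (Ha k).
exists (l +i* l')%C => eps eps0.
have [e Ee] := ge0_Re _ (ltW eps0); subst eps; rewrite (ltcR 0 e) in eps0.
have e2 : 0 < e / 2 by rewrite divr_gt0.
have [N _ HN] := (cvgrPdist_le _ _).1 Hl _ e2.
have [N' _ HN'] := (cvgrPdist_le _ _).1 Hl' _ e2.
exists (maxn N N') => n; rewrite geq_max => /andP[/HN/= {}HN /HN'/= {}HN'].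
apply: le_trans (normc_le_ReIm _) _; rewrite lecR (splitr e).
have ReD : {morph (@complex.Re R) : x y / x + y} by case=> ? ? [].
have ImD : {morph (@complex.Im R) : x y / x + y} by case=> ? ? [].
rewrite ReD ImD (big_morph _ ReD (erefl : complex.Re 0 = 0)).
rewrite (big_morph _ ImD (erefl : complex.Im 0 = 0)).
by apply: lerD; rewrite distrC; [move: HN|move: HN']; rewrite seriesEord.
Qed.

Lemma geom_tail_le (a : nat -> R[i]) K q n k : 0 <= q -> q < 1 ->
    (forall k, `|a k| <= K * q ^+ k) ->
  `|\sum_(i < n + k) a i - \sum_(i < n) a i| <= K * q ^+ n / (1 - q).
Proof.
move=> q0 q1 Ha; have K0 := bound_ge0 Ha.
rewrite big_split_ord /= [X in X - _]addrC addrK.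
apply: le_trans (ler_norm_sum _ _ _) _.
apply: le_trans (_ : \sum_(i < k) K * q ^+ n * q ^+ i <= _).
  by apply: ler_sum => i _; rewrite -mulrA -exprD; apply: Ha.
rewrite -big_distrr /= ler_wpM2l ?geom_sum_le //.
by rewrite mulr_ge0 // exprn_ge0.
Qed.

(** The sum [c] is chosen before the bound, so that one [c] has its tail controlled by every
    geometric bound. The estimate is that of a finite block whose end tends to infinity. *)
Lemma geom_bounded_sum_rate (a : nat -> R[i]) K q : 0 <= q -> q < 1 ->
    (forall k, `|a k| <= K * q ^+ k) ->
  exists c, forall K' q', 0 <= q' -> q' < 1 -> (forall k, `|a k| <= K' * q' ^+ k) ->
    forall n, `|\sum_(i < n) a i - c| <= K' * q' ^+ n / (1 - q').
Proof.
move=> q0 q1 Ha; have [c Hc] := geom_bounded_sum q0 q1 Ha.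
exists c => L s s0 s1 Hs n; apply/ler_addgt0Pr => eps /Hc[N HN].
have := HN _ (leq_addl n N); have := geom_tail_le n N s0 s1 Hs.
rewrite distrC => H1 H2.
apply: le_trans (lerD H1 H2); apply: le_trans (ler_normD _ _).
by rewrite addrA subrK.
Qed.

End Series.

(** * Closure of exponential polynomials with error term under Cauchy product and dilation *)

Section ExpPoly.
Variables (R : realType) (L : seq R[i]) (r : R[i]).
Local Notation C := R[i].
Implicit Types (f g h e : nat -> C).

Definition exp_poly_growth f : Prop :=
  exists p : C -> {poly C},
    growth r (fun k => f k - \sum_(mu <- L) mu ^+ k * (p mu).[k%:R]).

Hypotheses (uniqL : uniq L) (r_ge1 : 1 <= r).

Let r_ge0 : 0 <= r := le_trans ler01 r_ge1.

Lemma growth_exp_poly e : growth r e -> exp_poly_growth e.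
Proof.
move=> He; exists (fun=> 0).
rewrite (_ : (fun k => _) = e) //; apply: funext => k.
by rewrite big1 ?subr0 // => mu _; rewrite horner0 mulr0.
Qed.

Lemma exp_poly_exp_poly mu (p : {poly C}) :
  mu \in L -> exp_poly_growth (fun k => mu ^+ k * p.[k%:R]).
Proof.
move=> muL; exists (fun nu => if nu == mu then p else 0).
apply: (@growth_fin_support _ _ _ 0) => // k _.
rewrite (bigD1_seq mu) //= eqxx big1 ?addr0 ?subrr // => nu /negPf->.
by rewrite horner0 mulr0.
Qed.

Lemma exp_poly_growth_linear : linear_pred exp_poly_growth.
Proof.
have [GD GZ] := growth_linear r.
split=> [f g [p Hp] [q Hq]|c f [p Hp]].
  exists (fun mu => p mu + q mu); move: (GD _ _ Hp Hq); congr growth.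
  apply: funext => k; under [in RHS]eq_bigr do rewrite hornerD mulrDr.
  by rewrite big_split /= opprD addrACA.
exists (fun mu => c *: p mu); move: (GZ c _ Hp); congr growth.
apply: funext => k; rewrite mulrBr big_distrr /=; congr (_ - _).
by apply: eq_bigr => mu _; rewrite hornerZ mulrCA.
Qed.

(** Reduces linear properties to error terms and to [negbin], on which convolutions are explicit. *)
Lemma exp_poly_growth_ind (Q : (nat -> C) -> Prop) :
    linear_pred Q -> (forall e, growth r e -> Q e) ->
    (forall mu d, mu \in L -> Q (negbin mu d)) ->
  forall f, exp_poly_growth f -> Q f.
Proof.
move=> Qlin Qe Qb f [p /Qe Hp].
have := linear_pred_sum (r := L) (f := fun mu k => mu ^+ k * (p mu).[k%:R]) Qlin Hp.
rewrite (_ : (fun k => _) = f); last by apply: funext => k; rewrite addrC subrK.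
by apply=> mu muL; apply: exp_poly_ind => // d; apply: Qb.
Qed.

(** ['C(k+d, d)] is a polynomial in [k]: going from [d] to [d+1] multiplies it by
    [(k+d+1) / (d+1)]. *)
Lemma exp_poly_negbin mu d : mu \in L -> exp_poly_growth (negbin mu d).
Proof.
move=> muL; suff [p Ep] : exists p : {poly C}, forall k, 'C(k + d, d)%:R = p.[k%:R].
  rewrite (_ : negbin mu d = fun k => mu ^+ k * p.[k%:R]); first exact: exp_poly_exp_poly.
  by apply: funext => k; rewrite -Ep.
elim: d => [|d [p Ep]]; first by exists 1 => k; rewrite bin0 hornerC.
exists (d.+1%:R^-1 *: (p * ('X + d.+1%:R%:P))) => k.
rewrite hornerZ hornerM hornerD hornerX hornerC -Ep -natrD.
have /(congr1 (fun n => n%:R : C)) := mul_bin_diag (k + d.+1) d.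
rewrite addnS /= !natrM -addnS => E.
by rewrite ['C(_, _)%:R * _]mulrC E mulKf // pnatr_eq0.
Qed.

(* When [|mu| > r], the convolution of [e] with the powers of [mu] is
   [c * mu ^+ k] with [c = \sum_j e j / mu ^+ j], up to the tail of the series. *)
Lemma exp_poly_conv_geom_growth mu e :
  mu \in L -> growth r e -> exp_poly_growth (conv (geom mu) e).
Proof.
move=> muL He; have [RD RZ] := exp_poly_growth_linear.
have [le_mur|lt_rmu] := real_leP (normr_real mu) (ger0_real r_ge0).
  by apply: growth_exp_poly; apply: growth_conv => //; apply: growth_geom.
have mu_gt0 := le_lt_trans r_ge0 lt_rmu.
have mu_neq0 : mu != 0 by rewrite -normr_gt0.
pose a k := e k / mu ^+ k.
have aP t K : (forall k, `|e k| <= K * t ^+ k) ->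
    forall k, `|a k| <= K * (t / `|mu|) ^+ k.
  move=> HK k; rewrite /a normrM normfV normrX expr_div_n mulrA.
  by rewrite ler_wpM2r // invr_ge0 exprn_ge0.
have qP t : r < t -> t < `|mu| -> 0 <= t / `|mu| /\ t / `|mu| < 1.
  move=> lt_rt lt_tmu; split; last by rewrite ltr_pdivrMr ?mul1r.
  by rewrite divr_ge0 // (le_trans r_ge0) // ltW.
have [c Hc] : exists c, forall t K, r < t -> t < `|mu| ->
    (forall k, `|e k| <= K * t ^+ k) -> forall n,
    `|\sum_(i < n) a i - c| <= K * (t / `|mu|) ^+ n / (1 - t / `|mu|).
  have [lt_rt lt_tmu] := midf_lt lt_rmu; have [q0 q1] := qP _ lt_rt lt_tmu.
  have [K HK] := He _ lt_rt.
  have [c Hc] := geom_bounded_sum_rate q0 q1 (aP _ _ HK); exists c => t K' lt1 lt2 HK'.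
  by have [q0' q1'] := qP _ lt1 lt2; apply: Hc => //; apply: aP.
rewrite (_ : conv _ _ = fun k =>
  c * negbin mu 0 k + mu ^+ k * (\sum_(i < k.+1) a i - c)); last first.
  apply: funext => k; rewrite negbin0 /geom mulrBr addrCA [c * _]mulrC subrr addr0.
  rewrite convC big_distrr /=; apply: eq_bigr => i _; rewrite /a mulrCA; congr (_ * _).
  rewrite /geom expfB_cond // (negPf mu_neq0) add0n; exact: ltn_ord i.
apply: RD; first by apply: RZ; apply: exp_poly_negbin.
(* The tail estimate has ratio [t / |mu|], which is below 1 only for [t < |mu|]. *)
apply: growth_exp_poly; apply: (growth_below r_ge0 lt_rmu) => t lt_rt lt_tmu.
have [K HK] := He _ lt_rt; have [q0 q1] := qP _ lt_rt lt_tmu.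
exists (K * (t / `|mu|) / (1 - t / `|mu|)) => k.
rewrite normrM normrX; apply: le_trans (ler_wpM2l _ (Hc _ _ lt_rt lt_tmu HK _)) _.
  by rewrite exprn_ge0.
rewrite exprS !expr_div_n le_eqVlt; apply/orP; left; apply/eqP.
by field; rewrite subr_eq0 expf_neq0 gt_eqF //= gt_eqF.
Qed.

(** Partial fractions for [1 / ((1 - mu X)(1 - nu X))]. *)
Lemma conv_geom_split mu nu f : mu != nu ->
  conv (geom mu) (conv (geom nu) f) =
    fun k => (mu - nu)^-1 * (mu * conv (geom mu) f k + - nu * conv (geom nu) f k).
Proof.
move=> neq; have neq0 : mu - nu != 0 by rewrite subr_eq0.
have E : conv (geom mu) (geom nu) =
    fun k => (mu - nu)^-1 * (mu * geom mu k + - nu * geom nu k).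
  apply: funext => k; apply: (mulfI neq0).
  by rewrite conv_geom_geom mulVKf // mulNr /geom -!exprS.
by rewrite convA E convZl convDl !convZl.
Qed.

Lemma exp_poly_conv_geom mu f :
  mu \in L -> exp_poly_growth f -> exp_poly_growth (conv (geom mu) f).
Proof.
move=> muL; have [RD RZ] := exp_poly_growth_linear; move: f.
apply: (exp_poly_growth_ind (Q := fun f => exp_poly_growth (conv (geom mu) f)))
  => [||nu d nuL].
- by split=> [g h Hg Hh|c g Hg]; rewrite ?convDr ?convZr; [apply: RD|apply: RZ].
- by move=> e; apply: exp_poly_conv_geom_growth.
(* If [mu = nu], the order of the pole rises by one; otherwise partial fractions lower the order at
   [nu] step by step. *)
have [<-|neq] := eqVneq mu nu; first by rewrite conv_geom_negbin; apply: exp_poly_negbin.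
elim: d => [|d IHd].
  rewrite negbin0 -[geom nu]conv_unit conv_geom_split // !conv_unit -!negbin0.
  by apply: (RZ); apply: RD; apply: (RZ); apply: exp_poly_negbin.
rewrite -conv_geom_negbin conv_geom_split // conv_geom_negbin.
by apply: (RZ); apply: RD; apply: (RZ) => //; apply: exp_poly_negbin.
Qed.

Lemma exp_poly_conv f g :
  exp_poly_growth f -> exp_poly_growth g -> exp_poly_growth (conv f g).
Proof.
have [RD RZ] := exp_poly_growth_linear.
have convN mu d h : mu \in L -> exp_poly_growth h -> exp_poly_growth (conv (negbin mu d) h).
  move=> muL Hh; elim: d => [|d IHd]; first by rewrite negbin0; apply: exp_poly_conv_geom.
  by rewrite -conv_geom_negbin -convA; apply: exp_poly_conv_geom.
move=> Hf Hg; move: f Hf.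
apply: (exp_poly_growth_ind (Q := fun f => exp_poly_growth (conv f g)))
  => [||mu d muL].
- by split=> [f h Hf Hh|c f Hf]; rewrite ?convDl ?convZl; [apply: RD|apply: RZ].
- move=> e He; move: g Hg.
  apply: (exp_poly_growth_ind (Q := fun g => exp_poly_growth (conv e g)))
    => [||mu d muL].
  + by split=> [f h Hf Hh|c f Hf]; rewrite ?convDr ?convZr; [apply: RD|apply: RZ].
  + by move=> e' He'; apply: growth_exp_poly; apply: growth_conv.
  + by rewrite convC; apply: convN => //; apply: growth_exp_poly.
- exact: convN.
Qed.

(** On generating functions: drop the terms below [n0], then substitute [X^m] for [X]. *)
Definition dilate (m n0 : nat) f (n : nat) : C :=
  if (m %| n)%N && (n0 <= n %/ m)%N then f (n %/ m)%N else 0.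

Hypothesis L_le : forall mu, mu \in L -> `|mu| <= r ^+ 2.

Lemma exp_poly_dilate m n0 f :
  (0 < m)%N -> exp_poly_growth f -> exp_poly_growth (dilate m n0 f).
Proof.
have [RD RZ] := exp_poly_growth_linear.
case: m => [//|[|m]] _ Hf.
  rewrite (_ : dilate _ _ _ = fun k => f k + -1 * (if (k < n0)%N then f k else 0)).
    apply: RD => //; apply: RZ; apply: growth_exp_poly.
    by apply: (growth_fin_support (n := n0)) => // k; rewrite leqNgt => /negPf->.
  apply: funext => k; rewrite /dilate dvd1n divn1 ltnNge.
  by case: leqP => _ /=; rewrite ?mulr0 ?addr0 // mulN1r subrr.
have r2_ge0 : 0 <= r ^+ 2 by rewrite exprn_ge0.
(* Both the [mu] in [L] and the error rate [r] are bounded by [r ^+ 2]. *)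
have Hf2 : growth (r ^+ 2) f.
  move: f Hf; apply: exp_poly_growth_ind => [|e|mu d /L_le Hmu].
  - exact: growth_linear.
  - by apply: growth_le; rewrite expr2 ler_peMl.
  - exact: growth_negbin.
apply: growth_exp_poly => t lt_rt; have t0 := le_trans r_ge0 (ltW lt_rt).
have [|K HK] := Hf2 (t ^+ 2); first by rewrite ltrXn2r // nnegrE.
exists K => k; rewrite /dilate; case: ifP => [/andP[dvd_mk _]|_]; last first.
  by rewrite normr0 mulr_ge0 ?(bound_ge0 HK) // exprn_ge0.
(* The dilation factor is at least 2 here, so twice the quotient of [k] by it is at most [k]. *)
apply: le_trans (HK _) _; rewrite ler_wpM2l ?(bound_ge0 HK) // -exprM.
rewrite ler_weXn2l // ?(le_trans r_ge1) ?ltW //.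
by rewrite -[leqRHS](divnK dvd_mk) mulnC leq_mul.
Qed.

End ExpPoly.

(** * The truncated convolution as an iterated Cauchy product *)

Section TruncConv.
Variable R : realType.
Local Notation C := R[i].

Lemma trunc_conv_conv s (g : 'I_s -> nat -> C) (k0 m : 'I_s -> nat) :
    (forall i, (0 < m i)%N) ->
  trunc_conv g k0 m =
    \big[@conv C/@unit_seq C]_(i < s) dilate (m i) (k0 i) (g i).
Proof.
move=> m_gt0; apply: funext => k.
(* Both sides are the coefficient of [X^k] in the product of the [P i]. Stopping at [j = k] loses
   nothing up to that degree because [m i >= 1]. *)
pose P i : {poly C} := \sum_(j < k.+1 | (k0 i <= j)%N) g i j *: 'X^(m i * j).
have PE i n : (n < k.+1)%N -> (P i)`_n = dilate (m i) (k0 i) (g i) n.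
  move=> lt_nk; rewrite coef_sum /dilate.
  under eq_bigr do rewrite coefZ coefXn.
  case: ifP => [/andP[dvd_mn le_k0]|H].
    have lt_qk : (n %/ m i < k.+1)%N := leq_ltn_trans (leq_div _ _) lt_nk.
    rewrite (bigD1 (Ordinal lt_qk)) //= mulnC divnK // eqxx mulr1.
    rewrite big1 ?addr0 // => j /andP[_ neq_j].
    case: eqP => [En|]; last by rewrite mulr0.
    by case/eqP: neq_j; apply: val_inj; rewrite /= En mulKn.
  rewrite big1 // => j le_k0j; case: eqP => [En|]; last by rewrite mulr0.
  by move: H; rewrite En dvdn_mulr // mulKn // le_k0j.
have prodE (I : Type) (rI : seq I) (Q : I -> {poly C}) (f : I -> nat -> C) :
    (forall i n, (n < k.+1)%N -> (Q i)`_n = f i n) ->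
    forall n, (n < k.+1)%N ->
    (\prod_(i <- rI) Q i)`_n = (\big[@conv C/@unit_seq C]_(i <- rI) f i) n.
  move=> HQ; elim: rI => [|i rI IHr] n lt_nk; first by rewrite !big_nil coef1.
  by rewrite !big_cons; apply: coef_mul_conv lt_nk => j lt_j; [apply: HQ|apply: IHr].
rewrite -(prodE _ _ P) // /P bigA_distr_big_dep /= coef_sum /trunc_conv.
rewrite big_mkcond [RHS]big_mkcond /=; apply: eq_bigr => f _.
have -> : (f \in family (fun i (j : 'I_k.+1) => (k0 i <= j)%N)) =
    [forall i, (k0 i <= f i)%N] by [].
case: forallP => //= _; rewrite scaler_prod prodrXr coefZ coefXn eq_sym.
by case: eqP; rewrite ?mulr1 ?mulr0.
Qed.

End TruncConv.

(** * Spectral radius and the Ramanujan property *)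

Section Spectrum.
Variable R : realType.
Local Notation C := R[i].

Lemma spec_radius_ge n (A : 'M[C]_n) mu : mu \in spec A -> `|mu| <= spec_radius A.
Proof.
rewrite /spec_radius; elim: (spec A) => [//|nu r IHr].
(* The order on [R[i]] is partial; the maximum is well behaved because norms are real, hence
   comparable. *)
have bigmax_norm_real (l : seq C) : \big[Num.max/0]_(x <- l) `|x| \is Num.real.
  by elim/big_ind: _ => [|x y xR yR|x _]; [exact: real0|exact: max_real|exact: normr_real].
rewrite big_cons in_cons comparable_le_max ?real_comparable ?normr_real //.
by case/predU1P=> [->|/IHr->]; rewrite ?lexx ?orbT.
Qed.

Lemma mem_spec n (A : 'M[C]_n) mu : eigenvalue A mu -> mu \in spec A.
Proof.
rewrite eigenvalue_root_char /spec mem_undup; case: closed_field_poly_normal => /= l.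
move=> ->; rewrite (monicP (char_poly_monic A)) scale1r root_prod_XsubC //.
Qed.

(** With rho the spectral radius, the rates match through [t = sqrtC (rho + eps)], that is
    [eps = t ^+ 2 - rho]. *)
Lemma ramanujanE n (A : 'M[C]_n) (P : nat -> C) : 0 <= spec_radius A ->
  ramanujan A P <-> exp_poly_growth (spec A) (sqrtC (spec_radius A)) P.
Proof.
move=> rho0; split=> -[p Hp]; exists p => t.
  move=> lt_t; have r0 : 0 <= sqrtC (spec_radius A) by rewrite sqrtC_ge0.
  have t0 := le_trans r0 (ltW lt_t).
  have := Hp (t ^+ 2 - spec_radius A).
  rewrite addrCA subrr addr0 (sqrCK t0); apply.
  by rewrite subr_gt0 -[ltLHS]sqrtCK ltrXn2r ?nnegrE.
move=> t0; apply: Hp; rewrite ltr_sqrtC ?nnegrE ?ltrDl //.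
by rewrite addr_ge0 // ltW.
Qed.

End Spectrum.

Theorem theorem2p18 (R : realType) (V D : finType) (tl : D -> V) (inv : D -> D)
  (Hg : is_graph inv) (Hnh : no_half_loops inv)
  (Hconn : connected_graph tl inv) (Hpos : positive_order V D)
  (s : nat) (Hs : (0 < s)%N) (m k0 : 'I_s -> nat)
  (Hm : forall i, (0 < m i)%N) (Hk0 : forall i, (0 < k0 i)%N)
  (g : 'I_s -> nat -> R[i])
  (Hgr : forall i, ramanujan (hashimoto tl inv (R[i])) (g i)) :
  ramanujan (hashimoto tl inv (R[i])) (trunc_conv g k0 m).
Proof.
set H := hashimoto tl inv R[i] in Hgr *.
have rho_ge1 : 1 <= spec_radius H.
  rewrite -[leLHS]normr1; apply: spec_radius_ge; apply: mem_spec.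
  exact: hashimoto_eigenvalue1.
have rho_ge0 := le_trans ler01 rho_ge1.
have r_ge1 : 1 <= sqrtC (spec_radius H).
  by rewrite -[leLHS]sqrtC1 ler_sqrtC ?nnegrE.
apply/ramanujanE => //; rewrite trunc_conv_conv //.
have uniqL : uniq (spec H) := undup_uniq _.
elim/big_ind: _ => [|f f' Hf Hf'|i _].
(* The neutral element [unit_seq] vanishes from index 1 on. *)
- apply: growth_exp_poly; apply: (growth_fin_support (n := 1)) => // -[|k] //.
- exact: exp_poly_conv.
apply: exp_poly_dilate => // [mu muL|]; first by rewrite sqrtCK spec_radius_ge.
exact/ramanujanE.
Qed.
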